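(* Let $n\ge 1$ and let $R=(r_1,r_2,\ldots,r_n)$ be a feasible score sequence with normalized score vector $H_R=(h_1,\ldots,h_n)$, $h_i=r_i-(i-1)$. Then $|U_{\min}(R)|=1$ if and only if $H_R$ can be written as a concatenation $$H_R=(H_1,H_2,\ldots,H_m)$$ of finitely many (i.e. $m\ge 1$) consecutive segments, where every segment $H_i$, $i=1,\ldots,m$, is a symmetric vector (different segments may have different parameters $p_i$).
   Context: A tournament matrix of order $n$ is an $n\times n$ $(0,1)$-matrix $A=(a_{ij})$ with $A+A^{T}=J-I$, where $J$ is the all-ones matrix and $I$ the identity matrix (i.e. the adjacency matrix of an orientation of the complete graph on the ordered vertex set $\{1,\ldots,n\}$). Its score sequence is its row sum vector. A feasible score sequence of length $n$ is a nondecreasing integer vector $R=(r_1,\ldots,r_n)$ with $\sum_{i=1}^n r_i=\binom n2$ and $\sum_{i=1}^k r_i\ge\binom k2$ for $k=1,\ldots,n-1$. Let $\mathcal T(R)$ be the set of all $n\times n$ tournament matrices whose row sum vector is exactly $R$ (row $i$ has sum $r_i$). An upset of a tournament matrix $A=(a_{ij})$ is an entry $a_{ij}=1$ with $i<j$. $U_{\min}(R)$ denotes the set of all matrices in $\mathcal T(R)$ whose number of upsets is minimum among all matrices in $\mathcal T(R)$. The normalized score vector of $R$ is $H_R=(h_1,\ldots,h_n)$ with $h_i=r_i-(i-1)$. A (nonempty) integer vector $H$ is called symmetric if it is of the form $(0,\ldots,0)$ (one or more zeros), or of the form $(p,p-1,\ldots,1,0,\ldots,0,-1,-2,\ldots,-p)$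 for some positive integer $p$, with one or more zeros in the middle block. *)

(* Defs.v *)
From HB Require Import structures.
From mathcomp Require Import all_boot all_order all_algebra.

Set Implicit Arguments.
Unset Strict Implicit.
Unset Printing Implicit Defensive.

Import Order.TTheory GRing.Theory Num.Theory.
Local Open Scope ring_scope.

(* (0,1)-matrices are boolean matrices, so that they form a finite type; all
   arithmetic on them takes place over the integers through [mx01].
   Indices are 0-based: the paper's index i is the ordinal of value i - 1. *)
Definition mx01 n (A : 'M[bool]_n) : 'M[int]_n :=
  map_mx (fun b : bool => b%:R) A.

Definition tournament n (A : 'M[bool]_n) : bool :=
  mx01 A + (mx01 A)^T == const_mx 1 - 1%:M.

Definition feasible_score n (R : n.-tuple int) : Prop :=
  [/\ sorted <=%R R,
      \sum_(i < n) tnth R i = ('C(n, 2))%:Z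
    & forall k : nat, (1 <= k <= n.-1)%N ->
        ('C(k, 2))%:Z <= \sum_(i < n | (i < k)%N) tnth R i].

Definition score_class n (R : n.-tuple int) : {set 'M[bool]_n} :=
  [set A | tournament A & [forall i, \sum_j mx01 A i j == tnth R i]].

Definition upsets n (A : 'M[bool]_n) : {set 'I_n * 'I_n} :=
  [set ij : 'I_n * 'I_n | (ij.1 < ij.2)%N & A ij.1 ij.2].

Definition Umin n (R : n.-tuple int) : {set 'M[bool]_n} :=
  [set A in score_class R |
    [forall B in score_class R, #|upsets A| <= #|upsets B|]%N].

Definition normalized_score n (R : n.-tuple int) : n.-tuple int :=
  [tuple tnth R i - (i : nat)%:Z | i < n].

(* (p, p-1, ..., 1) *)
Definition descent_pos (p : nat) : seq int := [seq (p - i)%N%:Z | i <- iota 0 p].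

(* (-1, -2, ..., -p) *)
Definition descent_neg (p : nat) : seq int := [seq - i%:Z | i <- iota 1 p].

Definition symmetric_vector (H : seq int) : Prop :=
  (exists2 z : nat, (0 < z)%N & H = nseq z 0) \/
  (exists p z : nat, [/\ (0 < p)%N, (0 < z)%N
     & H = descent_pos p ++ nseq z 0 ++ descent_neg p]).

Definition symmetric_concatenation (H : seq int) : Prop :=
  exists Hs : seq (seq int),
    [/\ (1 <= size Hs)%N,
        forall Hi, Hi \in Hs -> symmetric_vector Hi
      & H = flatten Hs].

(* Main.v *)
(** Write h for the normalized score vector. The upsets of a tournament form a
    set E of pairs i < j in which vertex i has out-degree minus in-degree h_i,
    and E determines the tournament. So U_min(R) is a singleton iff the 0/1 flow
    problem with divergence h on the pairs i < j has a unique optimum, each pair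
    having cost 1.

    Sufficiency is linear programming duality: if a potential phi is such that E
    is exactly {i < j | phi_i - phi_j > 1/2} and phi_i - phi_j = 1/2 never
    occurs, then E is the unique optimum. On a symmetric segment with parameter
    p, phi = h / (2p + 1) works, and concatenated segments are handled by adding
    a large constant to the later ones.

    Necessity uses exchanges. In a unique optimum, i -> j -> k forces i -> k, and
    neither the swap of i -> k, j -> l into i -> l, j -> k nor the rerouting of
    i -> j -> k through another vertex is available. As R is nondecreasing, h
    drops by at most 1 at each step, so passing from vertex j to j+1 loses
    at most one arc, and none unless h drops. If a < b have a common target k,
    some vertex strictly between b and k is a target of a but not of b. Hence, if
    h_j <= h_(j+1), no arc leaves j and no arc enters j+1, and a strict ascent is
    crossed by no arc at all. Thus h is cut at its strict ascents into
    zero-sum segments p, ..., 1, 0, ..., 0, -1, ..., -q, and p = q. *)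

Require Import Defs.
From mathcomp Require Import all_boot all_order all_algebra.
From mathcomp Require Import zify ring lra.
Set Implicit Arguments.
Unset Strict Implicit.
Unset Printing Implicit Defensive.
Import Order.TTheory GRing.Theory Num.Theory.
Local Open Scope ring_scope.

(** * Arc relations losing at most one arc per step *)

(** Abstracts the upsets of a unique optimum on the vertices 0 to [m]. Working on [nat] gives
    successors without bound proofs and the reversal [i] to [m - i], which exchanges [sc_out] and
    [sc_in]. *)
Record staircase (m : nat) (e : rel nat) : Prop := Staircase {
  sc_gap : forall i j, e i j -> (i.+1 < j <= m)%N;
  sc_cross : forall a b c d, e a c -> e b d -> (a < d)%N -> (b < c)%N ->
    e a d || e b c;
  sc_out : forall j k, e j k -> ~~ e j.+1 k ->
    forall l, l != k -> e j.+1 l = e j l;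
  sc_in : forall i k, e i k.+1 -> ~~ e i k ->
    forall l, l != i -> e l k = e l k.+1 }.

(** The guard is there because truncated subtraction would send every [j > m] to the vertex 0. *)
Definition rev_rel (m : nat) (e : rel nat) : rel nat :=
  fun i j => (j <= m)%N && e (m - j)%N (m - i)%N.

Lemma staircase_rev m e : staircase m e -> staircase m (rev_rel m e).
Proof.
case=> gap cross out_ in_; rewrite /rev_rel; split.
- by move=> i j /andP[jm /gap]; lia.
- move=> a b c d /andP[cm ac] /andP[dm bd] ad bc.
  have := cross _ _ _ _ bd ac; rewrite dm cm; have := gap _ _ ac.
  by have := gap _ _ bd; move=> ? ? -> //; lia.
- move=> j k /andP[km jk]; rewrite km /= => njk l lk; have := gap _ _ jk => jkm.
  case: (leqP l m) => //= lm.
  have jE : (m - j)%N = (m - j.+1).+1 by lia.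
  by rewrite jE in jk *; apply: in_ jk njk _ _; lia.
- move=> i k /andP[km ik]; have := gap _ _ ik => ikm nik l li.
  have kE : (m - k)%N = (m - k.+1).+1 by lia.
  rewrite km ltnW //= in nik *; rewrite kE in nik *.
  by case: (leqP l m) => lm; apply: out_ ik nik _ _; lia.
Qed.

(* In a counterexample with k - b minimal, b.+1 misses k and k.-1 misses a, so
   a -> k and b.+1 -> k.-1 contradict [sc_cross]. *)
Lemma staircase_common_target m e a b k : staircase m e ->
  (a < b < k)%N -> e a k -> e b k ->
  (forall l, (b < l < k)%N -> e a l -> e b l) -> False.
Proof.
case=> gap cross out_ in_.
have [d] := ubnP (k - b); elim: d a b k => // d IH a b k bkd abk ak bk sub.
have bk1 := gap _ _ bk.
have nb1k : ~~ e b.+1 k.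
  apply/negP => b1k; apply: (IH a b.+1 k) => //; [lia|lia|].
  (* A target [l < k] of [a] would also be one of [b], and [(a, b, l)] would be a smaller
     counterexample. *)
  move=> l lk al; apply/negPn/negP => nb1l.
  have bl : e b l by apply: sub al; lia.
  by apply: (IH a b l) => //; [lia..|] => x xl ax; apply: sub ax; lia.
have kE : k = k.-1.+1 by lia.
have nak1 : ~~ e a k.-1.
  apply/negP => ak1; have bk1' : e b k.-1 by apply: sub ak1; lia.
  by apply: (IH a b k.-1) => //; [lia..|] => x xl ax; apply: sub ax; lia.
have bk1' : e b k.-1.
  have ak' := ak; rewrite kE in ak'.
  by rewrite (in_ _ _ ak' nak1) -?kE //; lia.
have b1k1 : e b.+1 k.-1 by rewrite (out_ _ _ bk nb1k) //; lia.
have := cross _ _ _ _ ak b1k1; rewrite (negPf nak1) (negPf nb1k).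
by move=> H; have : false by apply: H; have := gap _ _ b1k1; lia.
Qed.

(** Mirror image of [staircase_common_target] under [rev_rel]. *)
Lemma staircase_common_source m e a k l : staircase m e ->
  (a < k < l)%N -> e a k -> e a l ->
  (forall b, (a < b < k)%N -> e b l -> e b k) -> False.
Proof.
move=> se akl ak al sub; have [gap _ _ _] := se; have := gap _ _ al => alm.
apply: (staircase_common_target (staircase_rev se)
          (a := (m - l)%N) (b := (m - k)%N) (k := (m - a)%N)); rewrite /rev_rel.
- by lia.
- by rewrite leq_subr !subKn //; lia.
- by rewrite leq_subr !subKn //; lia.
- move=> x xa /andP[-> /=]; rewrite !subKn; [|lia..] => xl.
  by apply: sub xl; lia.
Qed.

(* For the largest in-neighbour i of j, i and i.+1 have the same targets except
   j; walking down from a target of i beyond j to j.+1 would then lose i and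
   i.+1 simultaneously. *)
Lemma staircase_no_crossing_left m e i j : staircase m e ->
  (forall l, ~~ e j l) -> (forall l, ~~ e l j.+1) -> e i j ->
  forall a b, (a <= j < b)%N -> ~~ e a b.
Proof.
move=> se nout nin; have [gap cross out_ in_] := se.
have exi : e i j -> exists i, e i j by exists i.
move=> {}/exi exi; have ubi l : e l j -> (l <= j)%N by move/gap; lia.
case: (ex_maxnP exi ubi) => {exi ubi} {}i ij imax.
have ni1j : ~~ e i.+1 j by apply/negP => /imax; lia.
have ncross d : ~~ e i (j.+1 + d)%N.
  elim: d => [|d IH]; first by rewrite addn0.
  apply/negP; rewrite addnS => ik.
  have i1k : e i.+1 (j.+1 + d).+1 by rewrite (out_ _ _ ij ni1j) //; lia.
  have i1k' : e i.+1 (j.+1 + d)%N by rewrite (in_ _ _ ik IH) //; lia.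
  by move: IH; rewrite -(out_ _ _ ij ni1j) ?i1k' //; lia.
(* Crossing [a -> b] with [i -> j] yields [a -> j], because [i] has no target beyond [j]. *)
have to_j a b : (a <= j < b)%N -> e a b -> e a j.
  move=> ajb ab.
  have aj : (a < j)%N.
    rewrite ltn_neqAle; case: eqP ab => [->|_] ab; last by lia.
    by rewrite (negPf (nout b)) in ab.
  have := cross _ _ _ _ ab ij aj; have := gap _ _ ij => ijm.
  have -> : b = (j.+1 + (b - j.+1))%N by lia.
  by rewrite (negPf (ncross _)) orbF; apply; lia.
move=> a b ajb; apply/negP => ab; have aj := to_j _ _ ajb ab.
(* By [to_j], every source of [b] before [j] is also a source of [j]. *)
apply: (staircase_common_source se _ aj ab); first by have := gap _ _ aj; lia.
by move=> x xj /to_j; apply; lia.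
Qed.

(** Reversal swaps the two emptiness hypotheses and turns the arc leaving [j.+1] into one entering
    the reversed [j]. *)
Lemma staircase_no_crossing_right m e j k : staircase m e ->
  (forall l, ~~ e j l) -> (forall l, ~~ e l j.+1) -> e j.+1 k ->
  forall a b, (a <= j < b)%N -> ~~ e a b.
Proof.
move=> se nout nin jk a b ajb; have [gap _ _ _] := se; have := gap _ _ jk => jkm.
apply/negP => ab; have := gap _ _ ab => abm.
suff: ~~ rev_rel m e (m - b)%N (m - a)%N.
  by rewrite /rev_rel leq_subr !subKn ?ab //; lia.
apply: (staircase_no_crossing_left (staircase_rev se)
          (i := (m - k)%N) (j := (m - j.+1)%N)); rewrite /rev_rel.
- by move=> l; rewrite !subKn ?(negPf (nin _)) ?andbF //; lia.
- move=> l; have -> : (m - (m - j.+1).+1 = j)%N by lia.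
  by rewrite (negPf (nout _)) andbF.
- by rewrite leq_subr !subKn //; lia.
- by lia.
Qed.

(** * Consequences of the exchange properties *)

Definition net (e : rel nat) (i k : nat) : int := (e i k)%:R - (e k i)%:R.

(** What necessity retains of a unique optimum: [rg_trans], [rg_cross] and [rg_path] each rule out
    one exchange, and [rg_step] reflects the monotonicity of the scores. *)
Record rigid (n : nat) (h : nat -> int) (e : rel nat) : Prop := Rigid {
  rg_lt : forall i j, e i j -> (i < j < n)%N;
  rg_net : forall i, (i < n)%N -> h i = \sum_(k < n) net e i k;
  rg_trans : transitive e;
  rg_cross : forall a b c d, e a c -> e b d -> (a < d)%N -> (b < c)%N ->
    e a d || e b c;
  rg_path : forall i j k l, e i j -> e j k -> (i < l < k)%N ->
    e i l || e l k;
  rg_step : forall i, (i.+1 < n)%N -> h i - 1 <= h i.+1 }.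

Lemma sum_two_negatives n (F : nat -> int) a b : (a < n)%N -> (b < n)%N ->
  a != b -> (forall k, (k < n)%N -> F k <= 0) -> F a < 0 -> F b < 0 ->
  \sum_(k < n) F k <= - 2.
Proof.
move=> an bn ab Fle Fa Fb.
rewrite (bigD1 (Ordinal an)) //= (bigD1 (Ordinal bn)) /=; last first.
  by rewrite -val_eqE /= eq_sym.
set S := bigop _ _ _; have : S <= 0 by apply: sumr_le0 => i _; apply: Fle.
by lia.
Qed.

(** Contribution of [x] to [h j.+1 - h j]. Since [rg_step] bounds the total below by -1, these
    contributions control the loss of arcs between [j] and [j.+1]. *)
Definition shift (e : rel nat) (j x : nat) : int := net e j.+1 x - net e j x.

Lemma sum_shift n h e j : rigid n h e -> (j.+1 < n)%N ->
  \sum_(k < n) shift e j k = h j.+1 - h j.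
Proof.
by move=> rg jn; rewrite sumrB -!(rg_net rg) //; lia.
Qed.

Lemma shift_gt0 e j x : 0 < shift e j x ->
  e j.+1 x && ~~ e j x || e x j && ~~ e x j.+1.
Proof.
by rewrite /shift /net; case: (e j.+1 x); case: (e x j.+1); case: (e j x);
  case: (e x j).
Qed.

Lemma shift_lt0 e j x : shift e j x < 0 ->
  e j x && ~~ e j.+1 x || e x j.+1 && ~~ e x j.
Proof.
by rewrite /shift /net; case: (e j.+1 x); case: (e x j.+1); case: (e j x);
  case: (e x j).
Qed.

(** An arc [i -> i.+1] makes every shift at [i] nonpositive by transitivity, while [x = i] and
    [x = i.+1] both contribute -1; the total -2 violates [rg_step]. *)
Lemma rigid_gap n h e i j : rigid n h e -> e i j -> (i.+1 < j)%N.
Proof.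
move=> rg ij; have /andP[ltij jn] := rg_lt rg ij.
rewrite ltn_neqAle ltij andbT; apply/eqP => jE; rewrite -jE in ij jn {ltij}.
have le0 k : (k < n)%N -> shift e i k <= 0.
  move=> kn; rewrite leNgt; apply/negP => /shift_gt0 /orP[] /andP[H /negP[]].
    exact: rg_trans rg _ _ _ ij H.
  exact: rg_trans rg _ _ _ H ij.
have irr k : e k k = false by apply/negP => /(rg_lt rg); lia.
have asym : e i.+1 i = false by apply/negP => /(rg_lt rg); lia.
have := sum_two_negatives (ltnW jn) jn _ le0.
rewrite (sum_shift rg) // /shift /net !irr ij asym => /(_ _ _ _).
by have := rg_step rg jn; lia.
Qed.

(* Vertices with shifts of opposite signs yield a cost-neutral exchange. *)
Lemma shift_same_sign n h e j x y : rigid n h e ->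
  0 < shift e j x -> shift e j y < 0 -> False.
Proof.
move=> rg /shift_gt0 + /shift_lt0; have gap := rigid_gap rg.
(* Two out-arcs or two in-arcs are swapped; an in-arc followed by an out-arc is rerouted from one of
   [j], [j.+1] to the other. The gap keeps the new pairs pointing forward. *)
case/orP=> /andP[e1 /negPf n1] /orP[] /andP[e2 /negPf n2].
- have := rg_cross rg e1 e2; rewrite n1 n2.
  by have := gap _ _ e1; have := gap _ _ e2; lia.
- have := rg_path rg (l := j) e2 e1; rewrite n1 n2.
  by have := gap _ _ e1; have := gap _ _ e2; lia.
- have := rg_path rg (l := j.+1) e1 e2; rewrite n1 n2.
  by have := gap _ _ e1; have := gap _ _ e2; lia.
- have := rg_cross rg e1 e2; rewrite n1 n2.
  by have := gap _ _ e1; have := gap _ _ e2; lia.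
Qed.

(** A negative shift excludes positive ones, so a second negative one would bring the total down to
    -2. *)
Lemma shift_lt0_unique n h e j k l : rigid n h e -> (j.+1 < n)%N ->
  (k < n)%N -> (l < n)%N -> l != k -> shift e j k < 0 -> shift e j l = 0.
Proof.
move=> rg jn kn ln lk sk.
have le0 x : (x < n)%N -> shift e j x <= 0.
  by move=> _; rewrite leNgt; apply/negP => /(shift_same_sign rg); apply; apply: sk.
apply/eqP; rewrite eq_le le0 // leNgt; apply/negP => sl.
have := sum_two_negatives ln kn lk le0 sl sk.
by rewrite (sum_shift rg) //; have := rg_step rg jn; lia.
Qed.

Lemma rigid_staircase n h e : rigid n h e -> staircase n.-1 e.
Proof.
move=> rg; have gap := rigid_gap rg; have lt := rg_lt rg.
have nle i j : (j <= i.+1)%N -> e i j = false.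
  by move=> ji; apply/negP => /gap; lia.
have nge i j : (n <= j)%N -> e i j = false.
  by move=> nj; apply/negP => /lt; lia.
split.
- by move=> i j ij; have := gap _ _ ij; have := lt _ _ ij; lia.
- exact: rg_cross rg.
- move=> j k jk njk l lk; have jk1 := gap _ _ jk; have jkn := lt _ _ jk.
  case: (leqP l j.+1) => lj; first by rewrite !nle //; lia.
  case: (leqP n l) => ln; first by rewrite !nge.
  (* Losing [j -> k] is a negative shift, so the shift at [l] vanishes; beyond [j.+1] only out-arcs
     enter it. *)
  have := @shift_lt0_unique _ _ _ j k l rg; rewrite /shift /net jk (negPf njk).
  rewrite (nle k j) ?(nle k j.+1) ?(nle l j) ?(nle l j.+1); [|lia..].
  by case: (e j.+1 l); case: (e j l); lia.
- move=> i k ik nik l li; have ik1 := gap _ _ ik; have ikn := lt _ _ ik.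
  case: (leqP k l) => lj; first by rewrite !nle //; lia.
  have := @shift_lt0_unique _ _ _ k i l rg; rewrite /shift /net ik (negPf nik).
  rewrite (nle k i) ?(nle k.+1 i) ?(nle k l) ?(nle k.+1 l); [|lia..].
  by case: (e l k.+1); case: (e l k); lia.
Qed.

(** A negative shift would be the only nonzero one and make [h] drop. Hence [j.+1] inherits all
    targets of [j], and [j] all sources of [j.+1], which the common target and source lemmas
    forbid. *)
Lemma rigid_ascent n h e j : rigid n h e -> (j.+1 < n)%N -> h j <= h j.+1 ->
  (forall l, ~~ e j l) /\ (forall l, ~~ e l j.+1).
Proof.
move=> rg jn hj; have gap := rigid_gap rg; have se := rigid_staircase rg.
have ge0 x : (x < n)%N -> 0 <= shift e j x.
  move=> xn; rewrite leNgt; apply/negP => sx.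
  have := sum_shift rg jn; rewrite (bigD1 (Ordinal xn)) //= big1 ?addr0; first by lia.
  move=> i ix; exact: (shift_lt0_unique rg jn xn (ltn_ord i)).
have nle a b : (b <= a.+1)%N -> e a b = false.
  by move=> ba; apply/negP => /gap; lia.
have lt a b : e a b -> (b < n)%N by move/(rg_lt rg); lia.
have outS l : e j l -> e j.+1 l.
  move=> jl; have := ge0 _ (lt _ _ jl); have := gap _ _ jl; rewrite /shift /net jl.
  move=> jl1; rewrite (nle l j) ?(nle l j.+1); [|lia..].
  by case: (e j.+1 l).
have inS l : e l j.+1 -> e l j.
  move=> lj; have lj1 := gap _ _ lj; have := ge0 l; rewrite /shift /net lj.
  rewrite (nle j l) ?(nle j.+1 l); [|lia..].
  by case: (e l j) => //; lia.
split=> l; apply/negP => jl; have := gap _ _ jl => jl1.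
  apply: (staircase_common_target se _ jl (outS _ jl)); first by lia.
  by move=> x _; exact: outS.
apply: (staircase_common_source se _ (inS _ jl) jl); first by lia.
by move=> x _; exact: inS.
Qed.

(** Only pairs inside the prefix contribute, and they cancel because [net] is antisymmetric. *)
Lemma sum_no_crossing n h e m : rigid n h e -> (m <= n)%N ->
  (forall a b, (a < m <= b)%N -> ~~ e a b) -> \sum_(i < m) h i = 0.
Proof.
move=> rg mn nc.
have netE i : (i < m)%N -> h i = \sum_(k < m) net e i k.
  move=> im; rewrite (rg_net rg); last by lia.
  rewrite -(subnKC mn) big_split_ord /= [X in _ + X]big1 ?addr0 // => k _.
  rewrite /net (negPf (nc _ _ _)); last by lia.
  by case: (boolP (e _ _)) => // /(rg_lt rg); lia.
rewrite (eq_bigr (fun i : 'I_m => \sum_(k < m) net e i k)); last first.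
  by move=> i _; apply: netE.
rewrite (eq_bigr _ (fun i _ => sumrB _ _ _ _)) sumrB exchange_big /= subrr //.
Qed.

(** Without a descent, [j] has no out-arc and [j.+1] no in-arc, which gives the signs; equality then
    forces two zeros, and a strict ascent is a cut. *)
Lemma rigid_dichotomy n h e j : rigid n h e -> (j.+1 < n)%N ->
  [\/ h j.+1 = h j - 1, h j = 0 /\ h j.+1 = 0 |
      [/\ h j <= 0, 0 <= h j.+1 & \sum_(i < j.+1) h i = 0]].
Proof.
move=> rg jn; have := rg_step rg jn.
have [hj _|] := leP (h j) (h j.+1); last by move=> *; constructor 1; lia.
have [nout nin] := rigid_ascent rg jn hj.
have h1 : h j <= 0.
  rewrite (rg_net rg); last by lia.
  by apply: sumr_le0 => k _; rewrite /net (negPf (nout k)); case: (e k j).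
have h2 : 0 <= h j.+1.
  rewrite (rg_net rg) //.
  by apply: sumr_ge0 => k _; rewrite /net (negPf (nin k)); case: (e j.+1 k).
have [hE|hlt] := eqVneq (h j) (h j.+1); first by constructor 2; split; lia.
constructor 3; split=> //; apply: (sum_no_crossing rg); first by lia.
have se := rigid_staircase rg.
(* A strict ascent has a positive shift: an arc leaving [j.+1] or entering [j], as the no-crossing
   lemmas require. *)
have [k|nex] := pickP (fun k : 'I_n => 0 < shift e j k); last first.
  have : \sum_(k < n) shift e j k <= 0.
    by apply: sumr_le0 => k _; rewrite leNgt nex.
  by rewrite (sum_shift rg) //; lia.
case/shift_gt0/orP => /andP[ek _].
  by move=> a b ab; apply: (staircase_no_crossing_right se nout nin ek); lia.
by move=> a b ab; apply: (staircase_no_crossing_left se nout nin ek); lia.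
Qed.

(** * Upsets as 0/1 flows *)

Definition forward n : {set 'I_n * 'I_n} := [set p : 'I_n * 'I_n | (p.1 < p.2)%N].

Definition edge_div n (p : 'I_n * 'I_n) (i : 'I_n) : int :=
  (p.1 == i)%:R - (p.2 == i)%:R.

Definition flow n (E : {set 'I_n * 'I_n}) (i : 'I_n) : int :=
  \sum_(p in E) edge_div p i.

(** The last clause expresses optimality and uniqueness at once: a competitor that is no larger must
    be [E]. *)
Definition unique_min_flow n (h : 'I_n -> int) (E : {set 'I_n * 'I_n}) : Prop :=
  [/\ E \subset forward n, flow E =1 h
    & forall F : {set 'I_n * 'I_n}, F \subset forward n -> flow F =1 h ->
        (#|F| <= #|E|)%N -> F = E].

Definition tournament_of n (E : {set 'I_n * 'I_n}) : 'M[bool]_n :=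
  \matrix_(i, j) if (i < j)%N then (i, j) \in E
                 else (j < i)%N && ((j, i) \notin E).

Lemma tournamentP n (A : 'M[bool]_n) :
  reflect (forall i j, A i j + A j i = (i != j) :> nat)%N (tournament A).
Proof.
apply: (iffP eqP) => [/matrixP eqA i j | eqA].
  have := eqA i j; rewrite !mxE -val_eqE.
  by case: (A i j); case: (A j i); case: eqP.
apply/matrixP => i j; have := eqA i j; rewrite !mxE.
by case: (A i j); case: (A j i); case: eqP.
Qed.

Lemma tournament_ofP n (E : {set 'I_n * 'I_n}) : tournament (tournament_of E).
Proof.
apply/tournamentP => i j; rewrite !mxE -val_eqE.
by case: (ltngtP i j) => //=; case: (_ \in E).
Qed.

Lemma upsets_tournament_of n (E : {set 'I_n * 'I_n}) :
  E \subset forward n -> upsets (tournament_of E) = E.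
Proof.
move=> /subsetP sE; apply/setP => -[i j]; rewrite inE mxE /=.
have := sE (i, j); rewrite inE /=.
by case: ltngtP => //=; case: (_ \in E) => // _ /(_ isT).
Qed.

Lemma tournament_of_upsets n (A : 'M[bool]_n) :
  tournament A -> tournament_of (upsets A) = A.
Proof.
move/tournamentP => tA; apply/matrixP => i j; rewrite !mxE !inE /=.
have := tA i j; rewrite -val_eqE.
by case: (ltngtP i j) => //= _; case: (A i j); case: (A j i).
Qed.

Lemma upsets_forward n (A : 'M[bool]_n) : upsets A \subset forward n.
Proof. by apply/subsetP => p; rewrite !inE => /andP[]. Qed.

Lemma sum_pairs n (E : {set 'I_n * 'I_n}) (F : 'I_n * 'I_n -> int) :
  \sum_(p in E) F p = \sum_i \sum_j (if (i, j) \in E then F (i, j) else 0).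
Proof. by rewrite big_mkcond pair_bigA; apply: eq_bigr => -[]. Qed.

Lemma flowE n (E : {set 'I_n * 'I_n}) i :
  flow E i = \sum_j (((i, j) \in E)%:R - ((j, i) \in E)%:R).
Proof.
rewrite /flow !sumrB !sum_pairs /=; congr (_ - _).
  rewrite (bigD1 i) //= [X in _ + X]big1 ?addr0 => [|a /negPf ai]; last first.
    by rewrite big1 // => b _; rewrite ai if_same.
  by apply: eq_bigr => b _; rewrite eqxx; case: (_ \in E).
apply: eq_bigr => a _; rewrite (bigD1 i) //= big1 ?addr0 => [|b /negPf bi].
  by rewrite eqxx; case: (_ \in E).
by rewrite bi if_same.
Qed.

Lemma sum_ord_ltn n b : (b <= n)%N -> \sum_(k < n) (k < b)%N%:R = b%:Z.
Proof.
move=> bn; rewrite -natr_sum -big_mkcond /= (big_ord_narrow bn).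
by rewrite sum1_card card_ord natz.
Qed.

(** Without upsets, vertex [i] (counted from 0) beats exactly its [i] predecessors; each upset
    starting or ending at [i] changes this by 1 or -1. *)
Lemma row_sum_upsets n (A : 'M[bool]_n) i : tournament A ->
  \sum_j mx01 A i j = i%:Z + flow (upsets A) i.
Proof.
move/tournamentP => tA.
rewrite -(sum_ord_ltn (ltnW (ltn_ord i))) flowE -big_split /=.
apply: eq_bigr => j _; rewrite !mxE !inE /=.
have := tA i j; rewrite -val_eqE.
by case: (ltngtP i j) => //= _; case: (A i j); case: (A j i).
Qed.

Lemma score_classP n (R : n.-tuple int) (A : 'M[bool]_n) :
  reflect (tournament A /\ flow (upsets A) =1 tnth (normalized_score R))
          (A \in score_class R).
Proof.
rewrite inE; apply: (iffP andP) => -[tA sA]; split=> //.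
  by move=> i; have /eqP := forallP sA i; rewrite row_sum_upsets // tnth_mktuple; lia.
by apply/forallP => i; rewrite row_sum_upsets // sA tnth_mktuple; lia.
Qed.

Lemma card_Umin1 n (R : n.-tuple int) :
  #|Umin R| = 1%N <-> exists E, unique_min_flow (tnth (normalized_score R)) E.
Proof.
split.
  move/eqP/cards1P => [A UA]; exists (upsets A).
  have /setIdP[/score_classP[tA fA] /forall_inP minA] : A \in Umin R by rewrite UA set11.
  split=> //; first exact: upsets_forward.
  move=> F fwF flF leFA; have uF := upsets_tournament_of fwF.
  have cF : tournament_of F \in score_class R.
    by apply/score_classP; split; [exact: tournament_ofP | rewrite uF].
  suff : tournament_of F \in Umin R by rewrite UA => /set1P <-.
  rewrite inE cF; apply/forall_inP => B /minA; rewrite uF.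
  exact: leq_trans.
case=> E [fwE flE minE]; have uE := upsets_tournament_of fwE.
apply/eqP/cards1P; exists (tournament_of E).
have cE : tournament_of E \in score_class R.
  by apply/score_classP; split; [exact: tournament_ofP | rewrite uE].
apply/setP => A; rewrite in_set1; apply/idP/eqP => [|->].
  case/setIdP=> /score_classP[tA fA] /forall_inP/(_ _ cE); rewrite uE => leA.
  by rewrite -(tournament_of_upsets tA) (minE (upsets A)) ?upsets_forward.
rewrite inE cE; apply/forall_inP => B /score_classP[tB fB]; rewrite uE leqNgt.
apply/negP => ltB; suff BE : upsets B = E by rewrite BE ltnn in ltB.
by apply: minE => //; [exact: upsets_forward | exact: ltnW].
Qed.

(** Replacing [X] by [Y] gives a competitor that is no larger, hence [E] itself; being disjoint from
    [E], [Y] is empty, and so is [X]. *)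
Lemma unique_min_flow_exchange n h (E X Y : {set 'I_n * 'I_n}) :
  unique_min_flow h E -> X \subset E -> Y \subset forward n ->
  [disjoint E & Y] -> flow X =1 flow Y -> (#|Y| <= #|X|)%N -> X = set0.
Proof.
case=> fwE flE minE sXE fwY dEY flXY leYX.
have dY : [disjoint E :\: X & Y] by apply: disjointWl dEY; exact: subsetDl.
have FE : (E :\: X) :|: Y = E.
  apply: minE.
  - by rewrite subUset fwY andbT; apply: subset_trans fwE; exact: subsetDl.
  - move=> i; have := flE i; rewrite /flow (big_setID X) (setIidPr sXE) /= => <-.
    rewrite (eq_bigl _ _ (fun p => in_setU p _ _)) bigU //= addrC.
    by congr (_ + _); symmetry; apply: flXY.
  - rewrite cardsU disjoint_setI0 // cards0 subn0 cardsD (setIidPr sXE).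
    by have := subset_leq_card sXE; lia.
have Y0 : Y = set0.
  have sYE : Y \subset E by rewrite -FE subsetUr.
  by rewrite -(setIidPr sYE) disjoint_setI0.
apply/setP => p; rewrite in_set0; apply/negP => pX.
by have := subsetP sXE p pX; rewrite -FE Y0 !inE pX.
Qed.

(** Phrased by total divergence so as to cover both the crossing swap and the rerouting of a
    path. *)
Lemma no_swap n h (E : {set 'I_n * 'I_n}) p q r s : unique_min_flow h E ->
  p \in E -> q \in E -> p != q -> r \notin E -> s \notin E -> r != s ->
  r \in forward n -> s \in forward n ->
  (forall i, edge_div p i + edge_div q i = edge_div r i + edge_div s i) -> False.
Proof.
move=> uE pE qE pq rE sE rs fr fs eqdiv.
have flow2 x y i : x != y -> flow [set x; y] i = edge_div x i + edge_div y i.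
  by move=> xy; rewrite /flow big_setU1 ?inE //= big_set1.
have /setP/(_ p) : [set p; q] = set0; last by rewrite !inE eqxx.
apply: (unique_min_flow_exchange uE (Y := [set r; s])).
- by rewrite subUset !sub1set pE.
- by rewrite subUset !sub1set fr.
- rewrite disjoint_sym disjoints_subset subUset !sub1set !inE rE //.
- by move=> i; rewrite !flow2 // eqdiv.
- by rewrite !cards2 pq rs.
Qed.

Lemma no_shortcut n h (E : {set 'I_n * 'I_n}) p q r : unique_min_flow h E ->
  p \in E -> q \in E -> p != q -> r \notin E -> r \in forward n ->
  (forall i, edge_div p i + edge_div q i = edge_div r i) -> False.
Proof.
move=> uE pE qE pq rE fr eqdiv.
have /setP/(_ p) : [set p; q] = set0; last by rewrite !inE eqxx.
apply: (unique_min_flow_exchange uE (Y := [set r])).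
- by rewrite subUset !sub1set pE.
- by rewrite sub1set.
- by rewrite disjoint_sym disjoints_subset sub1set inE.
- by move=> i; rewrite /flow big_setU1 ?inE //= !big_set1 eqdiv.
- by rewrite cards2 cards1.
Qed.

(** Extends [E] to [nat] by false, to match [rigid] and [staircase]. *)
Definition nat_rel n (E : {set 'I_n * 'I_n}) : rel nat :=
  fun i j => [exists p in E, (p.1 == i :> nat) && (p.2 == j :> nat)].

Lemma nat_relE n (E : {set 'I_n * 'I_n}) (i j : 'I_n) :
  nat_rel E i j = ((i, j) \in E).
Proof.
apply/existsP/idP => [[[a b]] /and3P[/= abE ai bj]|ijE].
  by rewrite -(val_inj (eqP ai : val a = val i)) -(val_inj (eqP bj : val b = val j)).
by exists (i, j); rewrite ijE !eqxx.
Qed.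

Lemma unique_min_flow_rigid n (h : nat -> int) (E : {set 'I_n * 'I_n}) :
  unique_min_flow (fun i : 'I_n => h i) E ->
  (forall i, (i.+1 < n)%N -> h i - 1 <= h i.+1) -> rigid n h (nat_rel E).
Proof.
move=> uE step; have [/subsetP fwE flE _] := uE.
have fw (i j : 'I_n) : (i, j) \in E -> (i < j)%N by move/fwE; rewrite inE.
have lt i j : nat_rel E i j -> (i < j < n)%N.
  by case/existsP=> -[a b] /and3P[/fw /= ab /eqP <- /eqP <-]; rewrite ab ltn_ord.
have ord i : (i < n)%N -> exists a : 'I_n, i = a by move=> lin; exists (Ordinal lin).
split=> //.
- move=> i lin; rewrite -[i]/(val (Ordinal lin)) -flE flowE.
  by apply: eq_bigr => k _; rewrite /net !nat_relE.
- move=> j i k ij jk; have /andP[_ jn] := lt _ _ ij; have /andP[jlk kn] := lt _ _ jk.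
  have /andP[ilj _] := lt _ _ ij; have lin : (i < n)%N by lia.
  case: (ord _ lin) (ord _ jn) (ord _ kn) ij jk ilj jlk => [a ->] [b ->] [c ->].
  rewrite !nat_relE => ab bc ltab ltbc; apply/negPn/negP => ac.
  apply: (no_shortcut uE ab bc _ ac).
  + by apply/eqP => -[abE _]; rewrite abE ltnn in ltab.
  + by rewrite inE /=; exact: ltn_trans ltbc.
  + by move=> x; rewrite /edge_div /=; ring.
- move=> i j k l ik jl il jk.
  have /andP[lik kn] := lt _ _ ik; have /andP[ljl ln] := lt _ _ jl.
  have lin : (i < n)%N by lia.
  have ljn : (j < n)%N by lia.
  case: (ord _ lin) (ord _ ljn) (ord _ kn) (ord _ ln) ik jl il jk {lik ljl}
    => [a ->] [b ->] [c ->] [d ->]; rewrite !nat_relE => ac bd ad bc.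
  rewrite -[_ || _]negbK negb_or; apply/negP => /andP[nad nbc].
  apply: (no_swap uE ac bd _ nad nbc); rewrite ?inE //.
  + by apply: contraNneq nad => -[_ <-].
  + by apply: contraNneq nbc => -[<- _].
  + by move=> x; rewrite /edge_div /=; ring.
- move=> i j k l ij jk /andP[il lk].
  have /andP[lij jn] := lt _ _ ij; have /andP[ljk kn] := lt _ _ jk.
  have lin : (i < n)%N by lia.
  have lln : (l < n)%N by lia.
  case: (ord _ lin) (ord _ jn) (ord _ kn) (ord _ lln) ij jk il lk {ljk} lij
    => [a ->] [b ->] [c ->] [d ->]; rewrite !nat_relE => ab bc ad dc ltab.
  rewrite -[_ || _]negbK negb_or; apply/negP => /andP[nad ndc].
  apply: (no_swap uE ab bc _ nad ndc); rewrite ?inE //.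
  + by apply/eqP => -[abE _]; rewrite abE ltnn in ltab.
  + by apply/eqP => -[adE _]; rewrite adE ltnn in ad.
  + by move=> x; rewrite /edge_div /=; ring.
Qed.

(** * Potentials certifying a unique optimum *)

(** Summation by parts: the total potential drop depends on [F] only through its divergence. *)
Lemma sum_potential n (phi : 'I_n -> rat) (F : {set 'I_n * 'I_n}) :
  \sum_(p in F) (phi p.1 - phi p.2) = \sum_i phi i * (flow F i)%:~R.
Proof.
under [RHS]eq_bigr => i _ do rewrite /flow rmorph_sum mulr_sumr.
rewrite exchange_big /=; apply: eq_bigr => -[a b] _ /=.
have pick c : \sum_i phi i * (c == i)%:R%:~R = phi c.
  rewrite (bigD1 c) //= eqxx mulr1 big1 ?addr0 // => i /negPf ic.
  by rewrite eq_sym ic mulr0.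
rewrite -[in LHS]pick -[X in _ - X = _]pick -sumrB.
by apply: eq_bigr => i _; rewrite -mulrBr -rmorphB.
Qed.

Definition steep (phi : nat -> rat) : rel nat :=
  fun i j => (i < j)%N && (2^-1 < phi i - phi j).

(** A dual certificate: [potential_neq] is strict complementary slackness, and [potential_net] makes
    the steep pairs a feasible flow. *)
Record potential (h : seq int) (phi : nat -> rat) : Prop := Potential {
  potential_neq : forall i j, (i < j < size h)%N -> phi i - phi j != 2^-1;
  potential_net : forall i, (i < size h)%N ->
    nth 0 h i = \sum_(k < size h) net (steep phi) i k }.

Lemma potential_unique_min_flow n (h : n.-tuple int) phi : potential h phi ->
  unique_min_flow (tnth h) [set p : 'I_n * 'I_n | steep phi p.1 p.2].
Proof.
case; rewrite size_tuple => phi_neq phi_net; set E := [set _ | _].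
have fwE : E \subset forward n by apply/subsetP => p; rewrite !inE => /andP[].
have flE : flow E =1 tnth h.
  move=> i; rewrite flowE (tnth_nth 0) phi_net //.
  by apply: eq_bigr => k _; rewrite /net !inE.
split=> // F /subsetP fwF flF leFE.
(* Drop minus cost, each arc costing 1/2: among forward pairs [E] consists of those with [w > 0], so
   [D] is termwise nonnegative. *)
pose w (p : 'I_n * 'I_n) := phi p.1 - phi p.2 - 2^-1.
pose D p := (if p \in E then w p else 0) - (if p \in F then w p else 0).
have D_ge0 p : 0 <= D p.
  rewrite /D /w inE /steep; have := fwF p; rewrite inE.
  have := phi_neq p.1 p.2; rewrite ltn_ord andbT.
  case: (p.1 < p.2)%N; last by case: (p \in F) => // _ /(_ isT).
  move=> /(_ isT); rewrite /=; case: (p \in F); case: ltP; lra.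
have D_sum : \sum_p D p <= 0.
  have sum_w (G : {set 'I_n * 'I_n}) : \sum_(p in G) w p =
      \sum_i phi (i : 'I_n) * (flow G i)%:~R - #|G|%:R / 2.
    by rewrite sumrB (sum_potential (fun i : 'I_n => phi i)) sumr_const mulr_natl.
  (* Equal divergences cancel the potential terms, leaving half of [#|F| - #|E|]. *)
  rewrite sumrB -!big_mkcond /= !sum_w.
  under eq_bigr => i _ do rewrite flE -flF.
  have : #|F|%:R <= #|E|%:R :> rat by rewrite ler_nat.
  set S := bigop _ _ _; lra.
have {D_sum} D0 : \sum_p D p = 0.
  by apply/eqP; rewrite eq_le D_sum sumr_ge0.
apply/setP => p; have : D p = 0 by apply: (psumr_eq0P _ D0) => // q _; exact: D_ge0.
have w_neq0 : p \in forward n -> w p != 0.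
  by rewrite inE /w subr_eq0 => lt_p; apply: phi_neq; rewrite lt_p ltn_ord.
have fE := subsetP fwE p; have fF := fwF p; rewrite /D.
case: (boolP (p \in E)) => [/fE pE | _]; case: (boolP (p \in F)) => [/fF pF | _] //.
  by move/eqP; rewrite subr0 (negPf (w_neq0 pE)).
by move/eqP; rewrite sub0r oppr_eq0 (negPf (w_neq0 pF)).
Qed.

Lemma potential_nil : potential [::] (fun=> 0).
Proof. by split=> // i j; rewrite /= ltn0 andbF. Qed.

Lemma potential_cat h1 h2 phi1 phi2 : potential h1 phi1 -> potential h2 phi2 ->
  exists phi, potential (h1 ++ h2) phi.
Proof.
case=> neq1 net1 [neq2 net2]; set n1 := size h1 in neq1 net1 *.
set n2 := size h2 in neq2 net2 *.
(* [B] dominates every [|phi1 i| + |phi2 k|], so no drop from the first block to the raised second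
   block is positive. *)
pose B := \sum_(i < n1) `|phi1 i| + \sum_(i < n2) `|phi2 i|.
pose phi i := if (i < n1)%N then phi1 i else phi2 (i - n1)%N + B.
have phiL i : (i < n1)%N -> phi i = phi1 i by rewrite /phi => ->.
have phiR i : phi (n1 + i)%N = phi2 i + B.
  by rewrite /phi ltnNge leq_addr addKn.
have phiLR i k : (i < n1)%N -> (k < n2)%N -> phi i - phi (n1 + k)%N <= 0.
  move=> lin lkn; rewrite phiL // phiR.
  have : `|phi1 i| + `|phi2 k| <= B.
    apply: lerD; first by rewrite (bigD1 (Ordinal lin)) //= lerDl sumr_ge0.
    by rewrite (bigD1 (Ordinal lkn)) //= lerDl sumr_ge0.
  have := ler_norm (phi1 i); have := ler_norm (- phi2 k); rewrite normrN; lra.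
have arcLL i k : (i < n1)%N -> (k < n1)%N -> steep phi i k = steep phi1 i k.
  by move=> lin lkn; rewrite /steep !phiL.
have arcRR i k : steep phi (n1 + i) (n1 + k) = steep phi2 i k.
  by rewrite /steep !phiR ltn_add2l; congr (_ && (_ < _)); ring.
have arcLR i k : (i < n1)%N -> (k < n2)%N -> steep phi i (n1 + k) = false.
  move=> lin lkn; rewrite /steep; have := phiLR _ _ lin lkn.
  by case: ltP; rewrite ?andbF //; lra.
have arcRL i k : (i < n1)%N -> steep phi (n1 + k) i = false.
  by move=> lin; rewrite /steep; case: ltnP => //; lia.
exists phi; split; rewrite size_cat -/n1 -/n2.
  move=> i j /andP[ij jn]; case: (ltnP j n1) => jn1.
    by rewrite !phiL ?neq1 ?ij //; lia.
  have jE : j = (n1 + (j - n1))%N by lia.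
  case: (ltnP i n1) => in1.
    have /(phiLR _ _ in1) : (j - n1 < n2)%N by lia.
    by rewrite -jE => phi_le; rewrite lt_eqF //; lra.
  have iE : i = (n1 + (i - n1))%N by lia.
  by rewrite iE jE !phiR opprD addrACA subrr addr0 neq2 //; lia.
move=> i lin; rewrite big_split_ord nth_cat /= -/n1; case: ifP => in1.
  rewrite net1 // [X in _ + X]big1 ?addr0 => [|k _].
    by apply: eq_bigr => k _; rewrite /net !arcLL.
  by rewrite /net arcLR // arcRL.
set i' := (i - n1)%N; have iE : i = (n1 + i')%N by lia.
have i'n : (i' < n2)%N by lia.
rewrite net2 // iE [X in _ = X + _]big1 ?add0r => [|k _].
  by apply: eq_bigr => k _; rewrite /net !arcRR.
by rewrite /net arcLR // arcRL.
Qed.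

(** Allowing [p = 0] absorbs the zero vectors into the general form. *)
Lemma symmetric_vectorP H : symmetric_vector H <->
  exists p z, (0 < z)%N /\ H = descent_pos p ++ nseq z 0 ++ descent_neg p.
Proof.
split=> [[[z z0 ->]|[p [z [_ z0 ->]]]]|[[|p] [z [z0 ->]]]].
- by exists 0%N, z; rewrite cats0.
- by exists p, z.
- by left; exists z; rewrite //= cats0.
- by right; exists p.+1, z.
Qed.

Lemma size_symmetric p z :
  size (descent_pos p ++ nseq z 0 ++ descent_neg p) = (p + z + p)%N.
Proof. by rewrite !size_cat !size_map !size_iota size_nseq addnA. Qed.

Lemma nth_symmetric p z i : (i < p + z + p)%N ->
  nth 0 (descent_pos p ++ nseq z 0 ++ descent_neg p) i =
  if (i < p)%N then p%:Z - i%:Z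
  else if (i < p + z)%N then 0 else (p + z)%N%:Z - i.+1%:Z.
Proof.
move=> ilt; rewrite !nth_cat !size_map !size_iota size_nseq.
case: ltnP => ip; first by rewrite (nth_map 0%N) ?size_iota // nth_iota //; lia.
case: ltnP => iz; case: ltnP => ipz; try lia; first by rewrite nth_nseq iz.
rewrite (nth_map 0%N) ?size_iota; last by lia.
by rewrite nth_iota; lia.
Qed.

Lemma half_lt_divr (d : int) (m : nat) : (0 < m)%N ->
  (2^-1 < d%:~R / m%:R :> rat) = (m%:Z < 2 * d).
Proof.
move=> m0; rewrite ltr_pdivlMr ?ltr0n // mulrC ltr_pdivrMr // mulrC.
by rewrite -(ltr_int rat) intrM.
Qed.

Lemma potential_symmetric p z :
  exists phi, potential (descent_pos p ++ nseq z 0 ++ descent_neg p) phi.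
Proof.
set h := _ ++ _; have sz : size h = (p + z + p)%N by apply: size_symmetric.
pose phi i : rat := (nth 0 h i)%:~R / (p + p).+1%:R.
have phiB i j : phi i - phi j = (nth 0 h i - nth 0 h j)%:~R / (p + p).+1%:R.
  by rewrite /phi -mulrBl -rmorphB.
(* Steep means that [h] drops by at least [p + 1], which only a positive entry followed by a
   negative one can achieve. *)
have arcE i k : (i < p + z + p)%N -> (k < p + z + p)%N ->
    steep phi i k = (i < p)%N && (p + z + i <= k)%N.
  move=> lin lkn; rewrite /steep phiB half_lt_divr // !nth_symmetric //.
  by do !case: ltnP => ?; lia.
exists phi; split; rewrite sz.
  (* A drop of exactly 1/2 would make the odd number [2p + 1] even. *)
  move=> i j ij; rewrite phiB; set d := _ - _; apply/eqP => dE.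
  have : (d * 2)%:~R = ((p + p).+1%:Z)%:~R :> rat.
    have dm : d%:~R = 2^-1 * (p + p).+1%:R :> rat by rewrite -dE divfK ?pnatr_eq0.
    by rewrite intrM dm mulrAC mulVf ?mul1r.
  by move/intr_inj; lia.
move=> i lin; rewrite nth_symmetric //.
have netE (k : 'I_(p + z + p)) : net (steep phi) i k =
    ((i < p)%N && (p + z + i <= k)%N)%:R - ((k < p)%N && (p + z + k <= i)%N)%:R.
  by rewrite /net !arcE.
rewrite (eq_bigr _ (fun k _ => netE k)).
case: ltnP => ip /=.
  transitivity (\sum_(k < p + z + p) (1 - (k < p + z + i)%N%:R : int)).
    by rewrite sumrB sum_ord_ltn ?sumr_const ?card_ord; lia.
  by apply: eq_bigr => k _; do !case: ltnP => ? //=; lia.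
case: ltnP => ipz.
  by rewrite big1 // => k _; do !case: leqP => ? //=; lia.
transitivity (- \sum_(k < p + z + p) (k < i.+1 - (p + z))%N%:R : int).
  by rewrite sum_ord_ltn; lia.
by rewrite -sumrN; apply: eq_bigr => k _; do !case: ltnP => ? //=; lia.
Qed.

Lemma symmetric_concatenation_potential h :
  symmetric_concatenation h -> exists phi, potential h phi.
Proof.
case=> Hs [_ + ->]; elim: Hs => [|H Hs IH] symH.
  by exists (fun=> 0); exact: potential_nil.
have [phi1 pot1] : exists phi, potential H phi.
  have /symmetric_vectorP[p [z [_ ->]]] := symH H (mem_head _ _).
  exact: potential_symmetric.
have [phi2 pot2] : exists phi, potential (flatten Hs) phi.
  by apply: IH => K KHs; apply: symH; rewrite inE KHs orbT.
exact: potential_cat pot1 pot2.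
Qed.

(** * Cutting the score vector at its ascents *)

(** The steps that occur inside a symmetric vector. *)
Definition flat_step (x y : int) : bool :=
  (y == x - 1) || (x == 0) && (y == 0).

Lemma descent_posS p : descent_pos p.+1 = p.+1%:Z :: descent_pos p.
Proof.
by rewrite /descent_pos /= subn0 (iotaDl 1 0) -map_comp.
Qed.

Lemma descent_negS q : descent_neg q.+1 = rcons (descent_neg q) (- q.+1%:Z).
Proof. by rewrite /descent_neg -[in LHS](addn1 q) iotaD map_cat add1n cats1. Qed.

Lemma sum_descent_neg q :
  \sum_(x <- descent_neg q) x = - \sum_(x <- descent_pos q) x.
Proof.
elim: q => [|q IH]; first by rewrite !big_nil oppr0.
by rewrite descent_negS descent_posS big_rcons big_cons IH opprD addrC.
Qed.

Lemma sum_descent_pos p : (\sum_(x <- descent_pos p) x) * 2 = p%:Z * p.+1%:Z.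
Proof.
elim: p => [|p IH]; first by rewrite big_nil.
by rewrite descent_posS big_cons mulrDl IH; lia.
Qed.

Lemma flat_path_neg q s : path flat_step (- q.+1%:Z) s ->
  s = [seq - i%:Z | i <- iota q.+2 (size s)].
Proof.
elim: s q => //= y s IH q /andP[+ ys]; rewrite /flat_step.
case/orP=> [/eqP yE | ]; last by lia.
have -> : y = - q.+2%:Z by lia.
by congr (_ :: _); apply: IH; have <- : y = - q.+2%:Z by lia.
Qed.

Lemma flat_path_zero s : path flat_step 0 s ->
  exists z q, 0 :: s = nseq z.+1 0 ++ descent_neg q.
Proof.
elim: s => [|y s IH] /=; first by exists 0%N, 0%N.
case/andP=> /orP[/eqP -> ys|/eqP -> /IH[z [q ->]]]; last by exists z.+1, q.
by exists 0%N, (size s).+1; rewrite /= {1}(flat_path_neg (q := 0) ys).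
Qed.

(** Above 0 the only flat step goes down by one, and the sign of the last entry ensures that 0 is
    reached. *)
Lemma flat_path_pos p s : path flat_step p%:Z s -> last p%:Z s <= 0 ->
  exists z q, p%:Z :: s = descent_pos p ++ nseq z.+1 0 ++ descent_neg q.
Proof.
elim: p s => [|p IH] s; first by move=> /flat_path_zero[z [q ->]] _; exists z, q.
case: s => [//|y s] /andP[/orP[/eqP yE|//] ys] lasts.
have {}yE : y = p%:Z by lia.
rewrite {}yE in ys lasts *; have [z [q ->]] := IH _ ys lasts.
by exists z, q; rewrite descent_posS.
Qed.

(** The ends [p] and [-q] of the segment agree because the zero sum gives [p(p+1) = q(q+1)]. *)
Lemma flat_path_symmetric x s : path flat_step x s -> 0 <= x ->
  last x s <= 0 -> \sum_(y <- x :: s) y = 0 -> symmetric_vector (x :: s).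
Proof.
case: x => // p xs _ /(flat_path_pos xs)[z [q ->]].
rewrite !big_cat big_nseq iter_addr_0 mul0rn sum_descent_neg /=.
have := sum_descent_pos p; have := sum_descent_pos q.
set P := bigop _ _ _; set Q := bigop _ _ _ => eQ eP PQ.
have -> : p = q by nia.
by apply/symmetric_vectorP; exists q, z.+1.
Qed.

Lemma symmetric_concatenation_cat h1 h2 : symmetric_vector h1 ->
  symmetric_concatenation h2 -> symmetric_concatenation (h1 ++ h2).
Proof.
move=> sym1 [Hs [_ symHs ->]]; exists (h1 :: Hs); split=> // H.
by rewrite inE => /predU1P[->|/symHs].
Qed.

(** Induction on the unread part [s], with [x :: t] the current segment: a flat junction extends it,
    any other closes it with sum 0. *)
Lemma symmetric_concatenation_split x t s : path flat_step x t -> 0 <= x ->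
  last x (t ++ s) <= 0 -> \sum_(y <- x :: t ++ s) y = 0 ->
  (forall s1 y z s2, x :: t ++ s = s1 ++ y :: z :: s2 ->
     flat_step y z \/ [/\ y <= 0, 0 <= z & \sum_(w <- rcons s1 y) w = 0]) ->
  symmetric_concatenation (x :: t ++ s).
Proof.
elim: s x t => [|y s IH] x t xt x0.
  rewrite cats0 => xt0 sumt _; exists [:: x :: t]; split=> //; last by rewrite /= cats0.
  by move=> H /[!inE] /eqP ->; apply: flat_path_symmetric.
move=> last_le sum0 junction.
have [|yt|[xt0 y0 sumt]] := junction (belast x t) (last x t) y s.
- by rewrite -[RHS]cat_rcons -lastI.
- rewrite -cat_rcons; apply: IH => //.
  + by rewrite rcons_path xt.
  + by rewrite cat_rcons.
  + by rewrite cat_rcons.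
  + by rewrite cat_rcons.
rewrite -lastI in sumt.
rewrite -cat_cons; apply: symmetric_concatenation_cat; first exact: flat_path_symmetric.
move: last_le sum0; rewrite last_cat -cat_cons big_cat /= sumt add0r => last_le sum0.
rewrite -[s]/([::] ++ s); apply: IH => // s1 a b s2 eqs.
(* The closed segment sums to 0, so prefix sums of the remainder equal those of the whole. *)
have [|?|[a0 b0]] := junction (x :: t ++ s1) a b s2.
- by rewrite /= -catA -eqs.
- by left.
- rewrite -cat_cons rcons_cat big_cat /= sumt add0r => ?; right; split=> //.
Qed.

(** No arc enters the first vertex or leaves the last, which gives the end signs; [rigid_dichotomy]
    supplies the junctions. *)
Lemma rigid_concatenation (h : seq int) e : (0 < size h)%N ->
  rigid (size h) (nth 0 h) e -> symmetric_concatenation h.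
Proof.
move=> h_gt0 rg.
have sumE m : (m <= size h)%N -> \sum_(i < m) nth 0 h i = \sum_(x <- take m h) x.
  move=> mh; rewrite (big_nth 0) size_takel // big_mkord.
  by apply: eq_bigr => i _; rewrite nth_take.
have sum0 : \sum_(x <- h) x = 0.
  rewrite -[h]take_size -sumE //; apply: (sum_no_crossing rg) => // a b ab.
  by apply/negP => /(rg_lt rg); lia.
have head_ge0 : 0 <= nth 0 h 0.
  rewrite (rg_net rg) //; apply: sumr_ge0 => k _; rewrite /net.
  by case: (boolP (e k 0%N)) => [/(rg_lt rg)|] //; case: (e 0%N k).
have last_le0 : last 0 h <= 0.
  rewrite -nth_last (rg_net rg) ?ltn_predL //.
  apply: sumr_le0 => k _; rewrite /net.
  have -> : e (size h).-1 k = false.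
    by apply/negP => /(rg_lt rg); have := ltn_ord k; lia.
  by case: (e k _).
have junction s1 y z s2 : h = s1 ++ y :: z :: s2 ->
    flat_step y z \/ [/\ y <= 0, 0 <= z & \sum_(w <- rcons s1 y) w = 0].
  move=> hE; have lt_s1 : ((size s1).+1 < size h)%N.
    by rewrite hE size_cat /= !addnS !ltnS leq_addr.
  have := rigid_dichotomy rg lt_s1; rewrite sumE; last by lia.
  have -> : nth 0 h (size s1) = y by rewrite hE nth_cat ltnn subnn.
  have -> : nth 0 h (size s1).+1 = z by rewrite hE nth_cat ltnNge leqnSn subSnn.
  have -> : take (size s1).+1 h = rcons s1 y.
    by rewrite hE -cat_rcons take_size_cat ?size_rcons.
  rewrite /flat_step; case=> [->|[-> ->]|?]; last by right.
    by left; rewrite eqxx.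
  by left; rewrite eqxx orbT.
case: h => [|x s] in h_gt0 rg sumE sum0 head_ge0 last_le0 junction *; first by [].
exact: (@symmetric_concatenation_split x [::] s).
Qed.

Theorem theorem1p5 (n : nat) (n_ge1 : (1 <= n)%N) (R : n.-tuple int)
    (feasR : feasible_score R) :
  #|Umin R| = 1%N <-> symmetric_concatenation (normalized_score R).
Proof.
split=> [/card_Umin1[E [fwE flE minE]] | /symmetric_concatenation_potential[phi pot]].
  set h := normalized_score R in flE minE *.
  have step i : (i.+1 < n)%N -> nth 0 h i - 1 <= nth 0 h i.+1.
    move=> lin; have [sortedR _ _] := feasR.
    have nthE (k : 'I_n) : nth 0 h k = nth 0 R k - (k : nat)%:Z.
      by rewrite -!tnth_nth tnth_mktuple.
    have := nthE (Ordinal lin); have := nthE (Ordinal (ltnW lin)) => /= -> ->.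
    rewrite -addn1 PoszD opprD addrA !lerD2r addn1.
    by apply: (sorted_leq_nth le_trans lexx) => //; rewrite ?inE ?size_tuple //; lia.
  (* Rigidity concerns functions on [nat], hence [nth 0]; below [n] the default is never read. *)
  have uE : unique_min_flow (fun i : 'I_n => nth 0 h i) E.
    split=> // [i|F fwF flF]; first by rewrite flE (tnth_nth 0).
    by apply: minE => // i; rewrite flF (tnth_nth 0).
  have rg := unique_min_flow_rigid uE step.
  by apply: (@rigid_concatenation h (nat_rel E)); rewrite size_tuple.
apply/card_Umin1; exists [set p : 'I_n * 'I_n | steep phi p.1 p.2].
exact: potential_unique_min_flow.
Qed.
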